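(* Let $G$ be a finite group and let $G=AB$ be the product of the subgroups $A$ and $B$. If $G=AB$ is a Baer factorisation, then: (1) $G/F(G)$ is abelian. (2) $G$ has abelian Sylow subgroups (that is, $G$ is an A-group) if and only if $F(G)$ is abelian. (3) Set $\sigma:=\{p\in\pi(G) : A_p \text{ and } B_p \text{ are non-abelian}\}$, where $A_p$ is a Sylow $p$-subgroup of $A$ and $B_p$ is a Sylow $p$-subgroup of $B$. Then $G=O_\sigma(G)\times O_{\sigma'}(G)$ with $O_\sigma(G)$ nilpotent. (4) If all Sylow subgroups of $A$ and $B$ are non-abelian, then $G$ is nilpotent.
   Context: All groups are finite. $\pi(G)$ is the set of prime divisors of $|G|$. For $x\in G$, the index of $x$ in $G$ is $i_G(x)=|G:C_G(x)|$. The number $1$ is regarded as a power of every prime. ''$G=AB$ is the product of the subgroups $A$ and $B$'' means that $G=\{ab : a\in A, b\in B\}$. $G=AB$ is a Baer factorisation if $i_G(x)$ is a prime power for every element $x\in A\cup B$ of prime power order. $F(G)$ is the Fitting subgroup of $G$; for a set of primes $\sigma$, $\sigma'$ is the complementary set of primes and $O_\sigma(G)$ is the largest normal $\sigma$-subgroup of $G$. *)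

(* Defs.v *)
From HB Require Import structures.
From mathcomp Require Import all_boot all_fingroup all_solvable.

Set Implicit Arguments.
Unset Strict Implicit.
Unset Printing Implicit Defensive.

Local Open Scope group_scope.

(* [k = 0] is allowed: 1 is a power of every prime. *)
Definition prime_power (n : nat) : Prop :=
  exists p k : nat, prime p /\ n = (p ^ k)%N.

Definition class_index (gT : finGroupType) (G : {group gT}) (x : gT) : nat :=
  #|G : 'C_G[x]|.

(* The condition on a factorisation [A * B = G]; that equation is a separate
   hypothesis. *)
Definition Baer_factorisation (gT : finGroupType) (G A B : {group gT}) : Prop :=
  forall x : gT, x \in A :|: B ->
    prime_power #[x] -> prime_power (class_index G x).

Definition A_group (gT : finGroupType) (G : {group gT}) : Prop :=
  forall (p : nat) (P : {group gT}), prime p -> p.-Sylow(G) P -> abelian P.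

(* The choice of the Sylow p-subgroup is immaterial, since they are conjugate.
   If p does not divide #|H|, the only one is trivial, hence abelian. *)
Definition nonabelian_Sylow (gT : finGroupType) (p : nat) (H : {group gT}) :
    bool :=
  [exists P : {group gT}, p.-Sylow(H) P && ~~ abelian P].

Definition nonabelian_primes (gT : finGroupType) (G A B : {group gT}) :
    nat_pred :=
  [pred p | [&& p \in \pi(G), nonabelian_Sylow p A & nonabelian_Sylow p B]].

(* Only the primes dividing #|H| are considered: for the others the Sylow
   p-subgroup is trivial and is not counted among the Sylow subgroups. *)
Definition all_Sylow_nonabelian (gT : finGroupType) (H : {group gT}) : Prop :=
  forall (p : nat) (P : {group gT}),
    p \in \pi(H) -> p.-Sylow(H) P -> ~~ abelian P.

(* Main.v *)
Require Import Defs.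
From mathcomp Require Import all_boot all_fingroup all_solvable.
From mathcomp Require Import integral_char.

(* Let x have prime power index q^a in G, so that G = C_G(x)Q for a Sylow
   q-subgroup Q.  If x is a p-element with q = p, then x lies in O_p(G).

   In a minimal counterexample to solvability no nontrivial normal subgroup is
   solvable, hence no two nontrivial normal subgroups commute.  If x and y have
   coprime indices and a conjugate of x commutes with y, the normal closures of x
   and y commute.  So if a nontrivial p-element x and a nontrivial r-element y
   have indices powers of distinct primes q and s, then p = s and r = q.  As
   q <> p always, this cannot hold for all the prime divisors of |G|, of which
   there are at least three by Burnside's p^a q^b theorem.

   In the solvable group G, x centralises every normal q'-subgroup, hence has a
   central image in F(G/O_q(G)).  This gives (1), and then that an element
   of a Sylow p-subgroup P of index a power of q <> p is central in P.  As
   P = A_p B_p for suitable Sylow subgroups, P is contained in O_p(G)Z(P), whence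
   (2).  If A_p and B_p are non-abelian, they are generated by their elements
   outside Z(P), which have p-power index; these lie in O_p(G) and are central
   modulo Phi(P), so that every p'-subgroup centralises P, whence (3) and (4). *)

Set Implicit Arguments.
Unset Strict Implicit.
Unset Printing Implicit Defensive.

Local Open Scope group_scope.

(** * Subgroups and centralisers of prime power index *)

Section PrimePowerIndex.

Variable gT : finGroupType.
Implicit Types (p q : nat) (pi : nat_pred) (x : gT)
  (G H K N P Q : {group gT}).

(** [#|K : H|] stands for |K : K ∩ H|; it equals |HK : H|, as HK is a subgroup of G. *)
Lemma pnat_index_in_normal pi G H K :
  H \subset G -> K \subset G -> G \subset 'N(K) -> pi.-nat #|G : H| ->
  pi.-nat #|K : H|.
Proof.
move=> sHG sKG nKG; apply: pnat_dvd.
have nKH : H \subset 'N(K) := subset_trans sHG nKG.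
rewrite -indexMg -norm_joinEl //.
by rewrite indexSg ?joing_subl // join_subG sHG.
Qed.

Lemma pnat_index_normal pi G H K :
  H <| G -> K \subset G -> pi.-nat #|G : H| -> pi.-nat #|K : H|.
Proof.
case/andP=> sHG nHG sKG; apply: pnat_dvd.
have nHK : K \subset 'N(H) := subset_trans sKG nHG.
by rewrite -indexMg -norm_joinEr // indexSg ?joing_subl // join_subG sHG sKG.
Qed.

Lemma pnat_index_p'group_sub pi G H :
  pi.-nat #|G : H| -> pi^'.-group G -> G \subset H.
Proof.
move=> piGH pi'G; rewrite -indexg_eq1 (pnat_1 piGH) //.
exact: pnat_dvd (dvdn_indexg _ _) pi'G.
Qed.

Lemma pnat_index_Sylow_mul q G H Q :
  H \subset G -> q.-nat #|G : H| -> q.-Sylow(G) Q -> H * Q = G.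
Proof.
move=> sHG qGH sylQ; apply: coprime_index_mulG => //.
  exact: pHall_sub sylQ.
by case/and3P: sylQ => _ _; apply: pnat_coprime.
Qed.

(** As q <> p, a Sylow p-subgroup of H is already one of G, and Sylow's theorem moves P into it. *)
Lemma pgroup_conj_sub_index p q G H P :
  H \subset G -> q.-nat #|G : H| -> q != p -> p.-group P -> P \subset G ->
  exists2 g, g \in G & P :^ g \subset H.
Proof.
move=> sHG qGH neq_qp pP sPG.
have [R sylR] := Sylow_exists p H.
have sylRG : p.-Sylow(G) R.
  rewrite pHallE (subset_trans (pHall_sub sylR) sHG) (card_Hall sylR).
  rewrite -(Lagrange sHG) partnM ?cardG_gt0 //
    [X in _ == (_ * X)%N]part_p'nat ?muln1 ?eqxx //.
  by apply: sub_in_pnat qGH => r _ /eqnP->; rewrite !inE.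
have [g Gg sPR] := Sylow_Jsub sylRG sPG pP.
by exists g => //; apply: subset_trans sPR (pHall_sub sylR).
Qed.

(** Otherwise, with C = C_G(F(G)) and Z = C ∩ F(G), the solvable group C/Z contains a nontrivial
    abelian M/Z normal in G/Z. As Z is central in M, M is nilpotent and normal, so it lies in F(G),
    hence in Z. *)
Lemma cent_Fitting_sub G : solvable G -> 'C_G('F(G)) \subset 'F(G).
Proof.
move=> solG; apply: contraT => nsCF; set C := 'C_G('F(G)) in nsCF.
pose Z := C :&: 'F(G).
have nsCG : C <| G by rewrite norm_normalI ?norms_cent ?gFnorm.
have nsZG : Z <| G by rewrite normalI ?Fitting_normal.
have nZC : C \subset 'N(Z) := subset_trans (normal_sub nsCG) (normal_norm nsZG).
have ntCZ : C / Z != 1.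
  by rewrite -subG1 quotient_sub1 //;
    apply: contra nsCF => /subset_trans-> //; apply: subsetIr.
have solC : solvable C := solvableS (normal_sub nsCG) solG.
have [] :=
  solvable_norm_abelem (quotient_sol _ solC) (quotient_normal Z nsCG) ntCZ.
move=> Mb [sMC nsMG ntM /is_abelemP[p _ /abelem_abelian abM]].
have [M defM sZM nsMG'] := inv_quotientN nsZG nsMG.
have sMC' : M \subset C.
  by rewrite -(quotientSGK _ (subsetIl _ _ : Z \subset C)) -?defM //
    (subset_trans (normal_sub nsMG')) ?normal_norm.
have cMZ : Z \subset 'Z(M).
  rewrite subsetI sZM; rewrite (subset_trans (subsetIr _ _)) // centsC.
  exact: subset_trans sMC' (subsetIr _ _).
suffices sMF : M \subset 'F(G).
  case/negP: ntM; rewrite defM -subG1 quotient_sub1 /=; last first.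
    exact: subset_trans sMC' nZC.
  by rewrite subsetI sMC'.
apply: Fitting_max nsMG' _; rewrite -quotient_center_nil abelian_nil //.
rewrite sub_der1_abelian // (subset_trans _ cMZ) // der1_min //.
  exact: subset_trans sMC' nZC.
by rewrite -defM.
Qed.

(** For a Sylow p-subgroup P containing x, G = C_G(x)P, so every conjugate of x is a P-conjugate and
    the normal closure of x lies in P. *)
Lemma pnat_index_pcore p G x :
  x \in G -> p.-elt x -> p.-nat #|G : 'C_G[x]| -> x \in 'O_p(G).
Proof.
move=> Gx px piGx.
have sxG : <[x]> \subset G by rewrite cycle_subG.
have [P sylP] := Sylow_superset sxG px; rewrite cycle_subG => Px.
have defG := pnat_index_Sylow_mul (subsetIl _ _) piGx sylP.
have sxGP : x ^: G \subset P.
  apply/subsetP=> _ /imsetP[g Gg ->].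
  have /mulsgP[c u /setIP[_ /cent1P cxc] Pu ->] : g \in 'C_G[x] * P.
    by rewrite defG.
  by rewrite conjgM (conjgE x c) -cxc mulKg groupJ.
have nxG : <<x ^: G>> <| G.
  by rewrite /normal gen_subG (subset_trans sxGP) ?(pHall_sub sylP) //
    norms_gen ?class_norm.
suffices: <<x ^: G>> \subset 'O_p(G).
  by move/subsetP; apply; rewrite mem_gen ?class_refl.
by rewrite pcore_max // (pgroupS _ (pHall_pgroup sylP)) // gen_subG.
Qed.

(** |K : C_K(x)| is a q-number because K is normal, and a q'-number because it divides |K|. *)
Lemma pnat_index_cent q G K x :
  K <| G -> q^'.-group K -> q.-nat #|G : 'C_G[x]| -> x \in 'C(K).
Proof.
case/andP=> sKG nKG q'K qGx.
have: K \subset 'C_G[x].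
  by apply: pnat_index_p'group_sub q'K; apply: pnat_index_in_normal qGx => //;
    apply: subsetIl.
by rewrite subsetI => /andP[_]; rewrite -cent_set1 centsC sub1set.
Qed.

Lemma pnat_index_quotient pi G N x :
  N <| G -> x \in G -> pi.-nat #|G : 'C_G[x]| ->
  pi.-nat #|G / N : 'C_(G / N)[coset N x]|.
Proof.
move=> /andP[sNG nNG] Gx; apply: pnat_dvd.
have nNC : 'C_G[x] \subset 'N(N) := subset_trans (subsetIl _ _) nNG.
apply: dvdn_trans (index_quotient (_ : G :&: 'C_G[x] \subset 'N(N)));
  last first.
  by rewrite subIset ?nNG.
rewrite indexgS // subsetI quotientS ?subsetIl //=.
apply/subsetP=> _ /morphimP[y Ny /setIP[_ /cent1P cxy] ->].
by apply/cent1P; rewrite /commute -!morphM ?cxy // (subsetP nNG).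
Qed.

End PrimePowerIndex.

(** * Elements of prime power index in solvable groups *)

Section Solvable.

Variable gT : finGroupType.
Implicit Types (p q s : nat) (x y : gT) (G P : {group gT}).

(** F(G/O_q(G)) is a q'-group since O_q(G/O_q(G)) = 1, so the image of x centralises it; by
    solvability the image then lies in it. *)
Lemma index_quotient_center_Fitting q G x :
  solvable G -> x \in G -> q.-nat #|G : 'C_G[x]| ->
  coset 'O_q(G) x \in 'Z('F(G / 'O_q(G))).
Proof.
move=> solG Gx qGx; set Q := 'O_q(G)%G.
have nsQG : Q <| G := pcore_normal q G.
have qGxb := pnat_index_quotient nsQG Gx qGx.
have q'F : q^'.-group 'F(G / Q).
  rewrite /pgroup -partn_eq1 ?cardG_gt0 //.
  by rewrite -(card_Hall (nilpotent_pcore_Hall q (Fitting_nil (G / Q)))) /=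
    p_core_Fitting trivg_pcore_quotient cards1.
have cFx := pnat_index_cent (Fitting_normal (G / Q)) q'F qGxb.
rewrite inE cFx andbT.
apply: (subsetP (cent_Fitting_sub (quotient_sol _ solG))).
by rewrite inE cFx mem_quotient.
Qed.

(** If q = s, x and y commute modulo O_q(G), which lies in F(G). Otherwise [x, y] centralises every
    O_r(G), hence F(G). *)
Lemma prime_power_indices_commg q s G x y :
  solvable G -> x \in G -> y \in G ->
  q.-nat #|G : 'C_G[x]| -> s.-nat #|G : 'C_G[y]| -> [~ x, y] \in 'F(G).
Proof.
move=> solG Gx Gy qGx sGy.
have nQG : G \subset 'N('O_q(G)) := gFnorm _ _.
have [eq_qs | neq_qs] := eqVneq q s.
  rewrite -eq_qs in sGy; apply: (subsetP (pcore_sub q _)).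
  rewrite p_core_Fitting.
  apply: coset_idr; first by rewrite groupR ?(subsetP nQG).
  rewrite morphR ?(subsetP nQG) //; apply/eqP/commgP.
  have /centerP[_ cx] := index_quotient_center_Fitting solG Gx qGx.
  by apply: cx; have /setIP[] := index_quotient_center_Fitting solG Gy sGy.
(* For each prime r, x or y centralises O_r(G). *)
apply: (subsetP (cent_Fitting_sub solG)).
rewrite inE groupR //= FittingEgen cent_gen.
have pcore_cent (r t : nat) z : r != t -> z \in G ->
  t.-nat #|G : 'C_G[z]| -> z \in 'C('O_r(G)).
  move=> neq_rt Gz tGz; apply: pnat_index_cent tGz; first exact: pcore_normal.
  by apply: sub_pgroup (pcore_pgroup _ _) => u /eqnP->; rewrite !inE.
rewrite -sub1set centsC; apply/bigcupsP=> r _; rewrite centsC sub1set.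
(* C(O_r(G)) is normalised by G, so it contains [x, y] as soon as it contains x or y. *)
have nCG : G \subset 'N('C('O_r(G))) by rewrite norms_cent ?gFnorm.
have [eq_rq | neq_rq] := eqVneq (r : nat) q; last first.
  by rewrite commgEl groupM ?groupV ?memJ_norm ?(subsetP nCG) //
    (pcore_cent r q).
rewrite commgEr groupM ?groupV ?memJ_norm ?(subsetP nCG) ?groupV //
  (pcore_cent r s) //.
all: by rewrite eq_rq.
Qed.

(** Modulo Q = O_q(G), the centraliser of x is normal of q-power index, so it contains the image of
    the p-group P. Hence [x, P] lies in Q ∩ P = 1. *)
Lemma pnat_index_center_Sylow p q G P x :
  solvable G -> abelian (G / 'F(G)) -> q.-nat #|G : 'C_G[x]| -> q != p ->
  p.-Sylow(G) P -> x \in P -> x \in 'Z(P).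
Proof.
move=> solG abGF qGx neq_qp sylP Px; have sPG := pHall_sub sylP.
have pP := pHall_pgroup sylP.
have Gx := subsetP sPG x Px; set Q := 'O_q(G)%G.
have nsQG : Q <| G := pcore_normal q G.
have nQG := normal_norm nsQG; have nQP := subset_trans sPG nQG.
have /centerP[_ cFx] := index_quotient_center_Fitting solG Gx qGx.
have qGxb := pnat_index_quotient nsQG Gx qGx.
set C := 'C_(G / Q)[coset Q x] in qGxb.
have sFC : 'F(G / Q) \subset C.
  rewrite subsetI Fitting_sub; apply/subsetP=> y Fy; apply/cent1P.
  exact: commute_sym (cFx y Fy).
(* C contains F(G/Q), hence the derived subgroup of G/Q. *)
have nsCG : C <| G / Q.
  apply: sub_der1_normal (subsetIl _ _); apply: subset_trans sFC.
  rewrite -quotient_der //; apply: subset_trans (morphim_Fitting _ _).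
  by rewrite quotientS // der1_min ?gFnorm.
have sPC : P / Q \subset C.
  apply: (@pnat_index_p'group_sub _ q).
    by apply: pnat_index_normal nsCG _ qGxb; apply: quotientS.
  apply: sub_pgroup (quotient_pgroup Q pP) => r /eqnP->.
  by rewrite !inE eq_sym.
rewrite inE Px; apply/centP=> y Py; apply/commgP.
suffices: [~ x, y] \in Q :&: P.
  rewrite coprime_TIg ?inE // (pnat_coprime (pcore_pgroup _ _)) //.
  by apply: sub_pgroup pP => r /eqnP->; rewrite !inE eq_sym.
rewrite inE (groupR Px Py) andbT; apply: coset_idr.
  by rewrite groupR ?(subsetP nQP).
rewrite morphR ?(subsetP nQP) //; apply/eqP/commgP/commute_sym.
by have /(subsetP sPC)/setIP[_ /cent1P] := mem_quotient Q Py.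
Qed.

End Solvable.

(** * Baer factorisations and their quotients *)

Lemma prime_power_p_elt (gT : finGroupType) p (x : gT) :
  prime p -> p.-elt x -> prime_power #[x].
Proof. by move=> p_pr /p_natP[k ->]; exists p, k. Qed.

Lemma Baer_index (gT : finGroupType) (G A B : {group gT}) p x :
  Baer_factorisation G A B -> prime p -> p.-elt x -> x \in A :|: B ->
  exists2 q, prime q & q.-nat #|G : 'C_G[x]|.
Proof.
move=> baerG p_pr px ABx.
have [q [k [q_pr eq_qk]]] := baerG x ABx (prime_power_p_elt p_pr px).
by exists q => //; rewrite -[#|_ : _|]/(class_index G x) eq_qk pnatX pnat_id.
Qed.

Lemma Baer_factorisation_quotient (gT : finGroupType) (G A B N : {group gT}) :
  A * B = G -> Baer_factorisation G A B -> N <| G ->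
  Baer_factorisation (G / N) (A / N) (B / N).
Proof.
move=> defG baerG nsNG xb ABxb [p [k [p_pr ox]]].
have sAG : A \subset G by rewrite -defG mulG_subl.
have sBG : B \subset G by rewrite -defG mulG_subr.
have nNG := normal_norm nsNG.
have [x ABx [Gx def_xb]] : exists2 x, x \in A :|: B & x \in G /\ xb = coset N x.
  case/setUP: ABxb => /morphimP[x _ Hx ->]; exists x;
    rewrite ?inE ?Hx ?orbT //; split=> //.
    exact: (subsetP sAG).
  exact: (subsetP sBG).
have Nx := subsetP nNG x Gx.
(* A lift of [xb] need not have prime power order, but its p-part does and is again a lift. *)
have def_xp : xb = coset N x.`_p.
  by rewrite def_xb in ox *; rewrite morph_constt // constt_p_elt //
    /p_elt ox pnatX pnat_id.
have ABxp : x.`_p \in A :|: B.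
  by case/setUP: ABx => Hx; apply/setUP; [left | right]; apply: groupX.
have [q q_pr qGx] := Baer_index baerG p_pr (p_elt_constt p x) ABxp.
rewrite /class_index def_xp.
have [m ->] := p_natP (pnat_index_quotient nsNG (groupX _ Gx) qGx).
by exists q, m.
Qed.

(** * Solvability *)

Lemma factor_p_elt (gT : finGroupType) (G A B : {group gT}) p :
  A * B = G -> p \in \pi(G) ->
  exists x, [/\ x \in A :|: B, x != 1 & p.-elt x].
Proof.
move=> defG; rewrite mem_primes => /and3P[p_pr _ pG].
have: p %| #|A| * #|B| by rewrite mul_cardG defG dvdn_mulr.
rewrite Euclid_dvdM // => /orP[] /(Cauchy p_pr)[x Hx ox]; exists x;
  by rewrite inE Hx ?orbT -order_gt1 /p_elt ox prime_gt1 ?pnat_id.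
Qed.

(** As s <> p, some conjugate x^g centralises y. Coprime indices give G = C_G(x^g)C_G(y), so every
    conjugate of x is conjugate to x^g under C_G(y) and centralises y too. *)
Lemma commuting_normal_closures (gT : finGroupType) (G : {group gT})
    (p q s : nat) (x y : gT) :
  x \in G -> y \in G -> p.-elt x -> q != s -> s != p ->
  q.-nat #|G : 'C_G[x]| -> s.-nat #|G : 'C_G[y]| ->
  <<y ^: G>> \subset 'C(<<x ^: G>>).
Proof.
move=> Gx Gy px neq_qs neq_sp qGx sGy.
have sxG : <[x]> \subset G by rewrite cycle_subG.
have [g Gg] := pgroup_conj_sub_index (subsetIl G 'C[y]) sGy neq_sp px sxG.
rewrite -cycleJ cycle_subG => /setIP[Gxg cyxg].
have qGxg : q.-nat #|G : 'C_G[x ^ g]|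
  by rewrite index_cent1 classGidl // -index_cent1.
have defG : 'C_G[x ^ g] * 'C_G[y] = G.
  apply: coprime_index_mulG; rewrite ?subsetIl //.
  apply: pnat_coprime qGxg _; apply: sub_in_pnat sGy => r _ /eqnP->.
  by rewrite !inE eq_sym.
have sxGC : x ^: G \subset 'C[y].
  apply/subsetP=> z; rewrite -(classGidl x Gg) => /imsetP[e].
  rewrite -{1}defG => /mulsgP[c d /setIP[_ /cent1P cxc] /setIP[_ Cd] -> ->].
  by rewrite conjgM (conjgE _ c) -cxc mulKg groupJ.
rewrite cent_gen gen_subG class_sub_norm ?norms_cent ?class_norm //.
by rewrite -sub1set centsC cent_set1.
Qed.

Lemma Baer_solvable (gT : finGroupType) (G A B : {group gT}) :
  A * B = G -> Baer_factorisation G A B -> solvable G.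
Proof.
have [n] := ubnP #|G|; elim: n => // n IHn in gT G A B *.
rewrite ltnS => leGn defG baerG; apply: contraT => nsolG.
have sABG : A :|: B \subset G by rewrite subUset -{1 2}defG mulG_subl mulG_subr.
have sol_quo (N : {group gT}) : N <| G -> N :!=: 1 -> solvable (G / N).
  move=> nsNG ntN; apply: (IHn _ _ (A / N)%G (B / N)%G) => /=.
  - by apply: leq_trans (ltn_quotient ntN (normal_sub nsNG)) leGn.
  - by rewrite -quotientMl ?defG // (subset_trans _ (normal_norm nsNG)) //
    -defG mulG_subl.
  - exact: Baer_factorisation_quotient.
have sol1 (N : {group gT}) : N <| G -> solvable N -> N :=: 1.
  move=> nsNG solN; apply/eqP; apply: contraR nsolG => ntN.
  by rewrite (series_sol nsNG) solN sol_quo.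
(* L ∩ M is abelian and normal, hence trivial, so M embeds in the solvable group G/L. *)
have not_cent (M L : {group gT}) :
    M <| G -> L <| G -> M :!=: 1 -> L :!=: 1 -> L \subset 'C(M) -> False.
  move=> nsMG nsLG ntM ntL cML; have tiLM: L :&: M = 1.
    apply: (sol1 (L :&: M)%G); first exact: normalI.
    by apply: abelian_sol; rewrite /abelian (subset_trans (subsetIl _ _)) //
      (subset_trans cML) ?centS ?subsetIr.
  have nLM : M \subset 'N(L).
    exact: subset_trans (normal_sub nsMG) (normal_norm nsLG).
  case/eqP: ntM; apply: sol1 => //; rewrite (isog_sol (quotient_isog nLM tiLM)).
  exact: solvableS (quotientS L (normal_sub nsMG)) (sol_quo L nsLG ntL).
have ncl z : z \in G -> z != 1 -> <<z ^: G>> <| G /\ <<z ^: G>> != 1.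
  move=> Gz ntz; split.
    by rewrite /normal gen_subG class_subG ?norms_gen ?class_norm.
  by apply: contraNneq ntz => z1;
    rewrite -in_set1 -[[set 1]]z1 mem_gen ?class_refl.
pose good (p q : nat) :=
  exists x, [/\ x \in G, x != 1, p.-elt x & q.-nat #|G : 'C_G[x]|].
have good_ex p :
    p \in \pi(G) -> exists2 q, good p q & (q \in \pi(G)) && (q != p).
  move=> piGp; have [x [ABx ntx px]] := factor_p_elt defG piGp.
  have p_pr : prime p by move: piGp; rewrite mem_primes => /andP[].
  have [q q_pr qGx] := Baer_index baerG p_pr px ABx.
  have Gx := subsetP sABG x ABx; have [nsx nt1] := ncl x Gx ntx.
  exists q; first by exists x.
  (* If q did not divide |G|, x would be central and its normal closure would commute with itself.
     If q = p, x would lie in O_p(G) = 1. *)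
  apply/andP; split.
    apply: contraT => pi'q; have sGC : G \subset 'C_G[x].
      apply: pnat_index_p'group_sub qGx _;
        apply: sub_in_pnat (pnat_pi (cardG_gt0 G)).
      by move=> r _ piGr; rewrite !inE; apply: contraNneq pi'q => <-.
    exfalso; apply: (not_cent _ _ nsx nsx nt1 nt1).
    rewrite /= cent_gen gen_subG class_sub_norm ?norms_cent ?class_norm //.
    rewrite -sub1set centsC cent_set1.
    rewrite (subset_trans (class_subG Gx (subxx _))) //.
    by rewrite (subset_trans sGC) ?subsetIr.
  apply: contraNneq ntx => eq_qp; rewrite eq_qp in qGx.
  have := pnat_index_pcore Gx px qGx.
  by rewrite (sol1 'O_p(G)%G) ?pcore_normal ?inE //
    (pgroup_sol (pcore_pgroup p G)).
have good_eq p q r s : good p q -> good r s -> q != s -> p = s.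
  move=> [x [Gx ntx px qGx]] [y [Gy nty _ sGy]] neq_qs.
  apply/eqP; apply: contraT => neq_ps.
  have [nsx nt1] := ncl x Gx ntx; have [nsy nt2] := ncl y Gy nty.
  exfalso; apply: (not_cent _ _ nsx nsy nt1 nt2).
  by apply: (commuting_normal_closures Gx Gy px neq_qs _ qGx sGy);
    rewrite eq_sym.
have gt2 : 2 < size (primes #|G|).
  by rewrite ltnNge; apply: contra nsolG; apply: Burnside_p_a_q_b.
have [p piGp] : exists p, p \in \pi(G).
  by exists (nth 0 (primes #|G|) 0); apply: mem_nth; apply: ltn_trans gt2.
(* [good p q] leads to [good q p]. For a third prime r with [good r t], t = q gives r = p, while t
   <> q gives t = p and then r = q. *)
have [q good_pq /andP[piGq neq_qp]] := good_ex p piGp.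
have [s good_qs /andP[_ neq_sq]] := good_ex q piGq.
have eq_ps : p = s by apply: good_eq good_pq good_qs _; rewrite eq_sym.
rewrite -{s}eq_ps in good_qs neq_sq.
have [r piGr /norP[neq_rp neq_rq]] :
    exists2 r, r \in \pi(G) & ~~ ((r == p) || (r == q)).
  have /allPn[r Gr nr] : ~~ all (mem [:: p; q]) (primes #|G|).
    apply/allP=> sub_pq; have := uniq_leq_size (primes_uniq _) sub_pq.
    by rewrite leqNgt gt2.
  by exists r; rewrite // -mem_seq2.
have [t good_rt _] := good_ex r piGr.
have [eq_tq | neq_tq] := eqVneq t q.
  by case/eqP: neq_rp; apply: good_eq good_rt good_qs _; rewrite eq_tq.
have eq_pt : p = t by apply: good_eq good_pq good_rt _; rewrite eq_sym.
by case/eqP: neq_rq; apply: good_eq good_rt good_pq _.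
Qed.


(** * The quotient by the Fitting subgroup *)

Lemma constt_mem (gT : finGroupType) (H : {group gT}) (x : gT) :
  (forall p : nat, p \in \pi(#[x]) -> x.`_p \in H) -> x \in H.
Proof.
move=> Hx; rewrite -(prod_constt x); apply: group_prod => p _.
have [/Hx // | pi'p] := boolP (p \in \pi(#[x])).
suffices -> : x.`_p = 1 by rewrite group1.
apply/constt1P; apply: sub_in_pnat (pnat_pi (order_gt0 x)) => r _ pir.
by rewrite !inE; apply: contraNneq pi'p => <-.
Qed.

(** The primary parts of the elements of A and B generate G, and any two of them have their
    commutator in F(G). *)
Lemma Baer_quotient_Fitting_abelian (gT : finGroupType) (G A B : {group gT}) :
  A * B = G -> Baer_factorisation G A B -> abelian (G / 'F(G)).
Proof.
move=> defG baerG; have solG := Baer_solvable defG baerG.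
have sABG : A :|: B \subset G by rewrite subUset -{1 2}defG mulG_subl mulG_subr.
(* Bounding p makes the condition boolean; a prime dividing the order of an element of G is at most
   |G|. *)
pose S := [set x in A :|: B |
  [exists p : 'I_#|G|.+1, prime p && (p : nat).-elt x]].
have sSG : S \subset G.
  by apply: subset_trans sABG; apply/subsetP=> x /setIdP[].
have S_gen x (H : {group gT}) : x \in H -> H \subset A :|: B -> x \in <<S>>.
  move=> Hx sHAB; apply: constt_mem => p pix; have := pix.
  rewrite mem_primes => /and3P[p_pr _ p_x]; apply: mem_gen.
  rewrite inE (subsetP sHAB) ?groupX //=; apply/existsP.
  have ltp : p < #|G|.+1.
    rewrite ltnS dvdn_leq ?cardG_gt0 // (dvdn_trans p_x) // order_dvdG //.
    exact: (subsetP (subset_trans sHAB sABG)).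
  by exists (Ordinal ltp); rewrite p_pr p_elt_constt.
have sGS : G \subset <<S>>.
  rewrite -defG mul_subG //; apply/subsetP=> x Hx; apply: S_gen Hx _.
    exact: subsetUl.
  exact: subsetUr.
have nFG : G \subset 'N('F(G)) := gFnorm _ _.
have nFS := subset_trans sSG nFG.
apply: abelianS (quotientS _ sGS) _; rewrite quotient_gen // abelian_gen.
apply/centsP=> _ /morphimP[x Nx Sx ->] _ /morphimP[y Ny Sy ->].
apply/commgP; rewrite -morphR //= coset_id //.
have [ABx /existsP[p /andP[p_pr px]]] := setIdP Sx.
have [ABy /existsP[r /andP[r_pr ry]]] := setIdP Sy.
have [q _ qGx] := Baer_index baerG p_pr px ABx.
have [s _ sGy] := Baer_index baerG r_pr ry ABy.
by apply: prime_power_indices_commg qGx sGy => //; apply: (subsetP sSG).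
Qed.

(** * Sylow subgroups of a factorised group *)

Lemma Sylow_factorisation (gT : finGroupType) (G A B : {group gT}) (p : nat) :
  A * B = G -> exists P Q R : {group gT},
  [/\ p.-Sylow(G) P, p.-Sylow(A) Q, p.-Sylow(B) R & Q * R = P].
Proof.
move=> defG.
have sAG : A \subset G by rewrite -defG mulG_subl.
have sBG : B \subset G by rewrite -defG mulG_subr.
have [Q sylQ] := Sylow_exists p A; have [R sylR] := Sylow_exists p B.
have [P sylP sQP] := Sylow_superset (subset_trans (pHall_sub sylQ) sAG)
  (pHall_pgroup sylQ).
have [g Gg sRP] := Sylow_Jsub sylP (subset_trans (pHall_sub sylR) sBG)
  (pHall_pgroup sylR).
(* Here R^g lies in P. Writing g^-1 = ab puts both Q^a and R^(b^-1) inside P^a, and they stay Sylow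
   in A and B. *)
have: g^-1 \in A * B by rewrite defG groupV.
case/mulsgP=> a b Aa Bb /(canRL invgK) def_g.
exists (P :^ a)%G, (Q :^ a)%G, (R :^ b^-1)%G.
have Ga := subsetP sAG a Aa.
have sylPa : p.-Sylow(G) (P :^ a) by rewrite pHallJ.
have sylQa : p.-Sylow(A) (Q :^ a) by rewrite pHallJ.
have sylRb : p.-Sylow(B) (R :^ b^-1) by rewrite pHallJ ?groupV.
split=> //; apply/eqP; rewrite eqEcard mul_subG ?conjSg //=; last first.
  by rewrite -sub_conjgV -conjsgM -invMg -def_g.
(* The product fills P^a by orders: |A||B| = |G||A ∩ B|, and the intersection has order at most the
   p-part of |A ∩ B|. *)
have tiQR : #|(Q :^ a) :&: (R :^ b^-1)| <= #|A :&: B|`_p.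
  apply: dvdn_leq => //; rewrite -(part_pnat_id (_ : p.-nat #|_ :&: _|)).
    rewrite partn_dvd ?cardG_gt0 // cardSg // setISS ?(pHall_sub sylQa) //.
    exact: pHall_sub sylRb.
  exact: pgroupS (subsetIl _ _) (pHall_pgroup sylQa).
rewrite (card_Hall sylPa) -(leq_pmul2r (cardG_gt0 (Q :^ a :&: R :^ b^-1))).
rewrite -mul_cardG (card_Hall sylQa) (card_Hall sylRb) -partnM //
  mul_cardG defG.
by rewrite partnM // leq_pmul2l.
Qed.

Lemma Baer_Sylow_elt (gT : finGroupType) (G A B P : {group gT}) p x :
  A * B = G -> Baer_factorisation G A B -> prime p -> p.-Sylow(G) P ->
  x \in P -> x \in A :|: B -> p.-nat #|G : 'C_G[x]| \/ x \in 'Z(P).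
Proof.
move=> defG baerG p_pr sylP Px ABx.
have px := mem_p_elt (pHall_pgroup sylP) Px.
have [q _ qGx] := Baer_index baerG p_pr px ABx.
have [eq_qp | neq_qp] := eqVneq q p; first by left; rewrite -eq_qp.
right; apply: pnat_index_center_Sylow qGx neq_qp sylP Px.
  exact: Baer_solvable defG baerG.
exact: Baer_quotient_Fitting_abelian defG baerG.
Qed.

(** Both factors of S = QR lie in O_p(G)Z(S), a product of two commuting abelian groups. *)
Lemma Baer_abelian_Sylow (gT : finGroupType) (G A B P : {group gT}) p :
  A * B = G -> Baer_factorisation G A B -> prime p -> abelian 'O_p(G) ->
  p.-Sylow(G) P -> abelian P.
Proof.
move=> defG baerG p_pr abO sylP.
have [S [Q [R [sylS sylQ sylR defS]]]] := Sylow_factorisation p defG.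
have [g _ ->] := Sylow_trans sylS sylP.
rewrite abelianJ; apply: (@abelianS _ _ ('O_p(G) <*> 'Z(S))); last first.
  rewrite abelianY abO center_abelian /= centsC.
  by rewrite (subset_trans (pcore_sub_Hall sylS)) // centsC subsetIr.
have sub_elt x : x \in S -> x \in A :|: B -> x \in 'O_p(G) <*> 'Z(S).
  move=> Sx ABx; have px := mem_p_elt (pHall_pgroup sylS) Sx.
  have Gx := subsetP (pHall_sub sylS) x Sx.
  have [pGx | Zx] := Baer_Sylow_elt defG baerG p_pr sylS Sx ABx.
    by apply: (subsetP (joing_subl _ _)); apply: pnat_index_pcore.
  exact: (subsetP (joing_subr _ _)).
rewrite -{1}defS mul_subG //; apply/subsetP=> x Hx; apply: sub_elt.
- by apply: (subsetP _ x Hx); rewrite -defS mulG_subl.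
- by rewrite inE (subsetP (pHall_sub sylQ)).
- by apply: (subsetP _ x Hx); rewrite -defS mulG_subr.
by rewrite inE (subsetP (pHall_sub sylR)) ?orbT.
Qed.

(** If c in C is outside Z(P) and x is in Z(P), then x = (xc)c^-1 with xc also outside Z(P). *)
Lemma nonabelian_sub (gT : finGroupType) (C P K : {group gT}) :
  C \subset P -> ~~ abelian C -> {in C, forall x, x \notin 'Z(P) -> x \in K} ->
  C \subset K.
Proof.
move=> sCP nabC CK.
have /subsetPn[c Cc nZc] : ~~ (C \subset 'Z(P)).
  by apply: contra nabC => sCZ; apply: abelianS sCZ (center_abelian P).
apply/subsetP=> x Cx; have [Zx | nZx] := boolP (x \in 'Z(P)); last exact: CK.
by rewrite -(groupMr x (CK c Cc nZc)) CK ?(groupM Cx Cc) ?(groupMl c Zx).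
Qed.

(** The alternatives [Q :=: 1] and [R :=: 1] admit primes dividing only one of |A| and |B|. *)
Lemma Baer_central_Sylow (gT : finGroupType) (G A B P Q R : {group gT}) p :
  A * B = G -> Baer_factorisation G A B -> prime p ->
  p.-Sylow(G) P -> Q \subset A -> R \subset B -> Q * R = P ->
  (Q :=: 1 \/ ~~ abelian Q) -> (R :=: 1 \/ ~~ abelian R) ->
  'O_p(G) = P /\ forall H : {group gT}, H \subset G -> p^'.-group H ->
    H \subset 'C(P).
Proof.
move=> defG baerG p_pr sylP sQA sRB defP nabQ nabR.
have sPG := pHall_sub sylP; have pP := pHall_pgroup sylP.
have sQP : Q \subset P by rewrite -defP mulG_subl.
have sRP : R \subset P by rewrite -defP mulG_subr.
have elt_pnat x : x \in P -> x \in A :|: B -> x \notin 'Z(P) ->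
  p.-nat #|G : 'C_G[x]|.
  by move=> Px ABx nZx;
    case: (Baer_Sylow_elt defG baerG p_pr sylP Px ABx) => // /idPn[].
(* P is generated by its elements of p-power index in G. This is applied to O_p(G), then to the
   elements of P central modulo Phi(P). *)
have sub_P (K : {group gT}) :
  {in P, forall x, p.-nat #|G : 'C_G[x]| -> x \in K} -> P \subset K.
- move=> KP; rewrite -defP mul_subG //.
    have [-> | nab] := nabQ; first exact: sub1G.
    apply: (nonabelian_sub sQP nab) => x Qx nZx.
    have Px := subsetP sQP x Qx.
    by apply: KP; rewrite ?elt_pnat // inE (subsetP sQA).
  have [-> | nab] := nabR; first exact: sub1G.
  apply: (nonabelian_sub sRP nab) => x Rx nZx.
  have Px := subsetP sRP x Rx.
  by apply: KP; rewrite ?elt_pnat // inE (subsetP sRB) ?orbT.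
have sPO : P \subset 'O_p(G).
  apply: sub_P => x Px pGx; apply: pnat_index_pcore pGx;
    first exact: (subsetP sPG).
  exact: mem_p_elt Px.
have defO : 'O_p(G) = P.
  by apply/eqP; rewrite eqEsubset sPO andbT (pcore_sub_Hall sylP).
have nsPG : P <| G by rewrite -defO pcore_normal.
split=> // H sHG p'H; pose N := 'Phi(P)%G.
have nsNG : N <| G := gFnormal_trans _ nsPG.
have nNG := normal_norm nsNG; have nNP := subset_trans sPG nNG.
have sPPhi : P \subset P :&: coset N @*^-1 'Z(G / N).
  apply: (sub_P (P :&: coset N @*^-1 'Z(G / N))%G) => x Px pGx.
  have Gx := subsetP sPG x Px; rewrite inE Px mem_morphpre ?(subsetP nNP) //.
  have pGxN := pnat_index_quotient nsNG Gx pGx.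
  have sPC : P / N \subset 'C_(G / N)[coset N x].
    rewrite subsetI quotientS //= -cent_set1 centsC sub1set.
    apply: (subsetP (abelem_abelian (Phi_quotient_abelem pP))).
    exact: mem_quotient.
  (* The index of xN divides |G : P|, and so is prime to p. *)
  have p'GxN : p^'.-nat #|G / N : 'C_(G / N)[coset N x]|.
    apply: pnat_dvd (indexgS _ sPC) _.
    apply: pnat_dvd (index_quotient _) _; first by rewrite subIset ?nNG.
    by case/and3P: sylP.
  have := pnat_1 pGxN p'GxN => /eqP; rewrite indexg_eq1 subsetI => /andP[_].
  by rewrite /= -cent_set1 centsC sub1set => cGx; rewrite inE mem_quotient.
have nPH : H \subset 'N(P) := subset_trans sHG (normal_norm nsPG).
have coPH : coprime #|P| #|H| := pnat_coprime pP p'H.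
have sPHN : [~: P, H] \subset N.
  rewrite -quotient_cents2 ?(subset_trans sHG) //.
  apply: subset_trans (_ : 'Z(G / N) \subset _); last first.
    by rewrite (subset_trans (subsetIr _ _)) // centS ?quotientS.
  by rewrite sub_quotient_pre // (subset_trans sPPhi) ?subsetIr.
have nNH := subset_trans sHG nNG.
(* H centralises P/Phi(P), and fixed points lift under coprime action, so P = Phi(P)C_P(H), whence P
   = C_P(H). *)
have defC : 'C_P(H) / N = P / N.
  rewrite coprime_norm_quotient_cent ?(coprimeSg (Phi_sub P)) //.
    by apply/setIidPl; rewrite quotient_cents2.
  exact: pgroup_sol (pgroupS (Phi_sub P) pP).
rewrite centsC -(Phi_nongen (_ : 'Phi(P) <*> 'C_P(H) = P))
  ?gen_subG ?subsetIr //.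
apply/eqP; rewrite eqEsubset join_subG Phi_sub subsetIl /=.
rewrite norm_joinEr; last by rewrite subIset ?nNP.
by rewrite -(quotientSK _ nNP) defC.
Qed.

(** * Splitting off a nilpotent direct factor *)

Lemma pcore_dprod_central_Sylows (gT : finGroupType) (G : {group gT})
    (pi : nat_pred) :
  solvable G ->
  (forall p : nat, p \in \pi(G) -> p \in pi ->
     p.-Sylow(G) 'O_p(G) /\
     forall H : {group gT}, H \subset G -> p^'.-group H ->
       H \subset 'C('O_p(G))) ->
  'O_pi(G) \x 'O_pi^'(G) = G /\ nilpotent 'O_pi(G).
Proof.
move=> solG centSyl; set F := 'F(G)%G.
have nsNG : 'O_pi(F) <| G := gFnormal_trans _ (Fitting_normal G).
(* For r in [pi], the Sylow subgroup O_r(G) lies in F(G), so r does not divide |G : F(G)|. Hence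
   O_pi(F(G)) is a Hall subgroup of G. *)
have pi'GF : pi^'.-nat #|G : F|.
  apply/pnatP=> // r r_pr r_GF; rewrite !inE; apply/negP=> pi_r.
  have piGr : r \in \pi(G).
    by rewrite mem_primes r_pr cardG_gt0 (dvdn_trans r_GF) ?dvdn_indexg.
  have [/and3P[_ _ r'GO] _] := centSyl r piGr pi_r.
  have sOF : 'O_r(G) \subset F by rewrite -p_core_Fitting pcore_sub.
  have: r \in \pi(#|G : F|) by rewrite mem_primes r_pr indexg_gt0.
  by move/(pnatPpi (pnat_dvd (indexgS G sOF) r'GO)); rewrite !inE eqxx.
have hallN : pi.-Hall(G) 'O_pi(F).
  have /and3P[sNF piN pi'FN] := nilpotent_pcore_Hall pi (Fitting_nil G).
  rewrite /pHall normal_sub // piN /= -(Lagrange_index (Fitting_sub G) sNF).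
  by rewrite pnatM pi'GF.
have defO : 'O_pi(G) = 'O_pi(F) := normal_Hall_pcore hallN nsNG.
split; last by rewrite defO (nilpotentS (pcore_sub _ _)) ?Fitting_nil.
have [H hallH] := Hall_exists pi^' solG.
(* H centralises each primary part of an element of O_pi(F(G)), so this normal Hall subgroup and its
   complement H form a direct product. *)
have cNH : H \subset 'C('O_pi(F)).
  rewrite centsC; apply/subsetP=> u Nu; apply: constt_mem => p pi_up.
  have Gu := subsetP (normal_sub nsNG) u Nu.
  have pi_p : p \in pi.
    exact: (pnatPpi (mem_p_elt (pcore_pgroup _ _) Nu) pi_up).
  have piGp : p \in \pi(G) by apply: (piSg _ pi_up); rewrite cycle_subG.
  have [sylO cO] := centSyl p piGp pi_p.
  have p'H : p^'.-group H.
    apply: sub_pgroup (pHall_pgroup hallH) => r; rewrite !inE.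
    by apply: contra => /eqP->.
  have sOC : 'O_p(G) \subset 'C(H) by rewrite centsC cO ?(pHall_sub hallH).
  apply: (subsetP sOC).
  by rewrite (mem_Hall_pcore sylO) ?p_elt_constt ?groupX.
have defG : 'O_pi(F) \x H = G.
  by rewrite dprodEsd //; apply/(sdprod_normal_p'HallP nsNG hallH).
have [_ nsHG] := dprod_normal2 defG.
by rewrite (normal_Hall_pcore hallH nsHG) defO.
Qed.

(** * The four conclusions *)

Lemma Sylow_nonabelian (gT : finGroupType) (H P Q : {group gT}) p :
  p.-Sylow(H) P -> p.-Sylow(H) Q -> ~~ abelian P -> ~~ abelian Q.
Proof.
by move=> sylP sylQ; have [x _ ->] := Sylow_trans sylP sylQ; rewrite abelianJ.
Qed.

Lemma all_Sylow_nonabelian_or1 (gT : finGroupType) (H P : {group gT}) p :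
  all_Sylow_nonabelian H -> p.-Sylow(H) P -> P :=: 1 \/ ~~ abelian P.
Proof.
move=> nabH sylP; have [piHp | pi'Hp] := boolP (p \in \pi(H)).
  by right; apply: nabH piHp sylP.
by left; apply: card1_trivg; rewrite (card_Hall sylP); apply/eqP;
  rewrite p_part_eq1.
Qed.

Theorem corollary3 (gT : finGroupType) (G A B : {group gT})
    (defG : A * B = G) (baerAB : Baer_factorisation G A B) :
  [/\ abelian (G / 'F(G)),
      A_group G <-> abelian 'F(G),
      (let sigma := nonabelian_primes G A B in
       'O_sigma(G) \x 'O_sigma^'(G) = G /\ nilpotent 'O_sigma(G))
    & all_Sylow_nonabelian A -> all_Sylow_nonabelian B -> nilpotent G].
Proof.
have solG := Baer_solvable defG baerAB.
have central p : p \in \pi(G) ->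
  (forall Q : {group gT}, p.-Sylow(A) Q -> Q :=: 1 \/ ~~ abelian Q) ->
  (forall R : {group gT}, p.-Sylow(B) R -> R :=: 1 \/ ~~ abelian R) ->
  p.-Sylow(G) 'O_p(G) /\
  forall H : {group gT}, H \subset G -> p^'.-group H -> H \subset 'C('O_p(G)).
- rewrite mem_primes => /andP[p_pr _] nabA nabB.
  have [P [Q [R [sylP sylQ sylR defP]]]] := Sylow_factorisation p defG.
  have [-> //] := Baer_central_Sylow defG baerAB p_pr sylP (pHall_sub sylQ)
    (pHall_sub sylR) defP (nabA Q sylQ) (nabB R sylR).
split.
- exact: Baer_quotient_Fitting_abelian defG baerAB.
- split=> [abG | abF p P p_pr sylP]; last first.
    apply: Baer_abelian_Sylow defG baerAB p_pr _ sylP.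
    by rewrite -p_core_Fitting; apply: abelianS abF; apply: pcore_sub.
  (* Each O_p(G) lies in an abelian Sylow subgroup, and for distinct primes these normal subgroups
     have coprime orders, so they commute. *)
  rewrite FittingEgen abelian_gen; apply/bigcupsP=> p piGp.
  rewrite centsC; apply/bigcupsP=> r _.
  have p_pr : prime p by move: piGp; rewrite mem_primes => /andP[].
  have [eq_rp | neq_rp] := eqVneq r p.
    have [P sylP] := Sylow_exists p G.
    by rewrite eq_rp; apply: abelianS (pcore_sub_Hall sylP) (abG p P p_pr sylP).
  have coO : coprime #|'O_r(G)| #|'O_p(G)|.
    apply: pnat_coprime (pcore_pgroup r G) _.
    apply: sub_pgroup (pcore_pgroup p G) => t /eqnP->.
    by rewrite !inE eq_sym; apply: neq_rp.
  rewrite (sameP commG1P trivgP) -(coprime_TIg coO) subsetI commg_subl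
    commg_subr.
  by rewrite !(subset_trans (pcore_sub _ _)) ?gFnorm.
- apply: pcore_dprod_central_Sylows => // p piGp /and3P[_ nabA nabB].
  apply: central => // [Q sylQ | R sylR]; right.
    by have /existsP[P /andP[sylP nabP]] := nabA;
      apply: Sylow_nonabelian sylP sylQ nabP.
  by have /existsP[P /andP[sylP nabP]] := nabB;
    apply: Sylow_nonabelian sylP sylR nabP.
move=> nabA nabB.
(* Taking all the primes of |G| makes the nilpotent factor G itself. *)
have [] := @pcore_dprod_central_Sylows _ G \pi(G) solG.
  move=> p piGp _; apply: central => // [Q sylQ | R sylR].
    exact: all_Sylow_nonabelian_or1 nabA sylQ.
  exact: all_Sylow_nonabelian_or1 nabB sylR.
by rewrite [in nilpotent _]pcore_pgroup_id ?pgroup_pi.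
Qed.
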